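(* Let $\mathbb K$ be a complete separable non-Archimedean valued field with nontrivial valuation, and let $\lambda,\mu\in\mathbb K$. For the operator $T_{\lambda,\mu}=\lambda I+\mu B$ acting on $c_0(\mathbb N)$, where $I$ is the identity and $B$ is the unilateral unweighted backward shift, the following statements are equivalent: (i) $T_{\lambda,\mu}$ satisfies the Supercyclic Criterion; (ii) $T_{\lambda,\mu}$ is supercyclic; (iii) $|\lambda|<|\mu|$.
   Context: A non-Archimedean valued field is a commutative field $\mathbb K$ with a map $|\cdot|:\mathbb K\to[0,+\infty)$ such that $|\lambda|=0$ iff $\lambda=0$, $|\lambda\mu|=|\lambda||\mu|$, and $|\lambda+\mu|\le\max\{|\lambda|,|\mu|\}$; the valuation is always assumed nontrivial. $\mathbb N=\{1,2,3,\dots\}$. $c_0(\mathbb N)=\{(x_n)_{n\in\mathbb N}: x_n\in\mathbb K,\ |x_n|\to 0\}$ with norm $\|\mathbf x\|=\sup_n|x_n|$, assumed to be a separable Banach space (equivalently, $\mathbb K$ is complete and separable). $B$ is the continuous linear operator on $c_0(\mathbb N)$ with $B(\mathbf e_1)=\mathbf 0$ and $B(\mathbf e_n)=\mathbf e_{n-1}$ for $n\ge 2$, where $\mathbf e_n$ has $n$-th coordinate $1$ and other coordinates $0$; i.e. $(B\mathbf x)_n=x_{n+1}$. A continuous linear operator $T$ on a normed space $X$ is supercyclic if there exists $\mathbf x\in X$ such that $\{\alpha T^n(\mathbf x): n\in\mathbb Z,\ n\ge 0,\ \alpha\in\mathbb K\}$ is dense in $X$. $T$ satisfies the Supercyclic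 Criterion if there exist a (strictly) increasing sequence of nonnegative integers $(n_k)$, two dense sets $\mathcal D_1,\mathcal D_2\subset X$ and a sequence of maps $S_{n_k}:\mathcal D_2\to X$ (not assumed linear or continuous) such that, as $k\to\infty$: (1) $\|T^{n_k}(\mathbf x)\|\,\|S_{n_k}(\mathbf y)\|\to 0$ for any $\mathbf x\in\mathcal D_1$ and any $\mathbf y\in\mathcal D_2$; (2) $T^{n_k}S_{n_k}(\mathbf y)\to\mathbf y$ for any $\mathbf y\in\mathcal D_2$. *)

(* Defs.v *)
From HB Require Import structures.
From mathcomp Require Import all_boot all_order all_algebra.
From mathcomp Require Import all_classical all_reals topology.

Set Implicit Arguments.
Unset Strict Implicit.
Unset Printing Implicit Defensive.

Import Order.TTheory GRing.Theory Num.Theory.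
Import numFieldTopology.Exports.

Local Open Scope classical_set_scope.
Local Open Scope ring_scope.

(* MathComp's `|_| cannot be used for a non-Archimedean absolute value: its    *)
(* axioms force `|x *+ n| = `|x| *+ n.  Hence [nval] and [nnorm] below.        *)

(* Join required by HB; it can only be declared before the structures of       *)
(* normedtype_theory are loaded, hence the import of [topology] alone.         *)
HB.structure Definition MetricZmodule (R : realType) :=
  {V of GRing.Zmodule V & Metric R V}.

HB.mixin Record Metric_isNAValued (R : realType) K
    & GRing.Field K & Metric R K := {
  nval : K -> R ;
  nval_ge0 : forall x, 0 <= nval x ;
  nval_eq0 : forall x, nval x = 0 <-> x = 0 ;
  nvalM : forall x y, nval (x * y) = nval x * nval y ;
  nvalD : forall x y, nval (x + y) <= Num.max (nval x) (nval y) ;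
  nval_nontrivial : exists2 x, x != 0 & nval x != 1 ;
  mdist_nval : forall x y : K, mdist x y = nval (x - y)
}.

#[short(type="naValuedFieldType")]
HB.structure Definition NAValuedField (R : realType) :=
  {K of GRing.Field K & Metric R K & Pointed K & Metric_isNAValued R K}.

#[short(type="completeNAValuedFieldType")]
HB.structure Definition CompleteNAValuedField (R : realType) :=
  {K of NAValuedField R K & Complete K}.

HB.mixin Record Metric_isNANormed (R : realType) (K : naValuedFieldType R) X
    & GRing.Lmodule K X & Metric R X := {
  nnorm : X -> R ;
  nnorm_ge0 : forall x, 0 <= nnorm x ;
  nnorm_eq0 : forall x, nnorm x = 0 <-> x = 0 ;
  nnormZ : forall (a : K) x, nnorm (a *: x) = nval a * nnorm x ;
  nnormD : forall x y, nnorm (x + y) <= Num.max (nnorm x) (nnorm y) ;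
  mdist_nnorm : forall x y : X, mdist x y = nnorm (x - y)
}.

#[short(type="naNormedModType")]
HB.structure Definition NANormedModule (R : realType) (K : naValuedFieldType R) :=
  {X of GRing.Lmodule K X & Metric R X & Metric_isNANormed R K X}.

Definition separable_space (T : topologicalType) :=
  exists2 D : set T, countable D & dense D.

Section Supercyclicity.
Variables (R : realType) (K : naValuedFieldType R) (X : naNormedModType K).

Definition supercyclic (T : {linear X -> X}) :=
  exists x : X, dense [set y | exists (a : K) (n : nat), y = a *: iter n T x].

Definition supercyclic_criterion (T : {linear X -> X}) :=
  exists (n_ : nat -> nat) (D1 D2 : set X) (S : nat -> D2 -> X),
    [/\ {homo n_ : k l / (k < l)%N}, dense D1, dense D2,
        forall x (y : D2), D1 x ->
          (fun k => nnorm (iter (n_ k) T x) * nnorm (S (n_ k) y)) @ \oo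
            --> (0 : R)
      & forall y : D2,
          (fun k => iter (n_ k) T (S (n_ k) y)) @ \oo --> (val y : X)].

End Supercyclicity.

Section Valuation.
Variables (R : realType) (K : naValuedFieldType R).
Implicit Types x y : K.

Lemma nval0 : nval (0 : K) = 0.
Proof. exact/nval_eq0. Qed.

Lemma nval1 : nval (1 : K) = 1.
Proof.
have n1 : nval (1 : K) != 0 by apply/eqP => /nval_eq0/eqP; rewrite oner_eq0.
by apply: (mulfI n1); rewrite -nvalM !mulr1.
Qed.

Lemma nvalN x : nval (- x) = nval x.
Proof.
apply/eqP; rewrite -(eqrXn2 (ltn0Sn 1)) ?nval_ge0//.
by rewrite !expr2 -!nvalM mulrNN.
Qed.

End Valuation.

Section C0.
Variables (R : realType) (K : naValuedFieldType R).

(* Coordinates are indexed from 0: [x n] is the (n+1)-st coordinate of x. *)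
Definition c0_pred : {pred nat -> K^o} :=
  fun x => `[< (fun n => nval (x n)) @ \oo --> (0 : R) >].

Lemma c0_predP (x : nat -> K^o) : reflect
  (forall e : R, 0 < e -> \forall n \near \oo, nval (x n) < e) (x \in c0_pred).
Proof.
apply: (iffP (asboolP _)).
  move=> /cvg_ballP h e /h; apply: filterS => n.
  by rewrite /ball/= sub0r normrN ger0_norm// nval_ge0.
move=> h; apply/cvg_ballP => e /h; apply: filterS => n.
by rewrite /ball/= sub0r normrN ger0_norm// nval_ge0.
Qed.

Lemma c0_submod_closed : submod_closed c0_pred.
Proof.
split.
  by apply/c0_predP => e e0; near=> n; rewrite nval0.
move=> a x y /c0_predP hx /c0_predP hy; apply/c0_predP => e e0.
have a1 : 0 < nval a + 1 by rewrite ltr_wpDl ?nval_ge0.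
have := hx _ (divr_gt0 e0 a1); have := hy _ e0.
apply: filterS2 => n yn xn; rewrite (le_lt_trans (nvalD _ _))// gt_max yn andbT.
rewrite nvalM; apply: le_lt_trans (_ : (nval a + 1) * nval (x n) < e).
  by rewrite ler_wpM2r ?nval_ge0// lerDl.
by rewrite mulrC -ltr_pdivlMr.
Unshelve. all: by end_near. Qed.

HB.instance Definition _ :=
  GRing.isSubmodClosed.Build K (nat -> K^o) c0_pred c0_submod_closed.

Record c0 := C0 { c0_val :> nat -> K^o ; _ : c0_val \in c0_pred }.

HB.instance Definition _ := [isSub for c0_val].
HB.instance Definition _ := [Choice of c0 by <:].
HB.instance Definition _ := [SubChoice_isSubLmodule of c0 by <:].

Definition c0_norm (x : c0) : R := sup (range (fun n => nval (x n : K))).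

Lemma c0_has_ubound (x : c0) : has_ubound (range (fun n => nval (x n : K))).
Proof.
case: x => x /= /c0_predP/(_ _ ltr01)[N _ hN].
exists (1 + \sum_(i < N) nval (x i)) => _ [n _ <-].
have s0 (P : pred 'I_N) : 0 <= \sum_(i < N | P i) nval (x i).
  by apply: sumr_ge0 => i _; exact: nval_ge0.
have [Nn|nN] := leqP N n.
  by rewrite (le_trans (ltW (hN _ Nn)))// lerDl s0.
by rewrite (bigD1 (Ordinal nN))//= addrCA lerDl addr_ge0.
Qed.

Lemma nval_le_c0_norm (x : c0) n : nval (x n : K) <= c0_norm x.
Proof. by apply: ub_le_sup; [exact: c0_has_ubound|exists n]. Qed.

Lemma c0_norm_le (x : c0) (e : R) :
  (forall n, nval (x n : K) <= e) -> c0_norm x <= e.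
Proof.
by move=> h; apply: ge_sup; [exists (nval (x 0 : K)), 0|move=> _ [n _ <-]].
Qed.

Lemma c0_norm_ge0 x : 0 <= c0_norm x.
Proof. exact: le_trans (nval_ge0 _) (nval_le_c0_norm x 0). Qed.

Lemma c0_norm_eq0 x : c0_norm x = 0 <-> x = 0.
Proof.
split=> [x0|->]; last first.
  apply/eqP; rewrite eq_le c0_norm_ge0 andbT.
  by apply: c0_norm_le => n; rewrite nval0.
apply/val_inj/funext => n /=; apply/nval_eq0/eqP.
by rewrite eq_le nval_ge0 andbT -x0 nval_le_c0_norm.
Qed.

Lemma c0_normZ (a : K) x : c0_norm (a *: x) = nval a * c0_norm x.
Proof.
have le (b : K) y : c0_norm (b *: y) <= nval b * c0_norm y.
  apply: c0_norm_le => n.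
  by rewrite [X in nval X]/(b * y n) nvalM ler_wpM2l ?nval_ge0 ?nval_le_c0_norm.
have [->|a0] := eqVneq a 0.
  by rewrite scale0r nval0 mul0r; apply/c0_norm_eq0.
apply/eqP; rewrite eq_le le/=.
have na0 : nval a != 0 by apply/eqP => /nval_eq0/eqP; exact/negP.
have na : 0 < nval a by rewrite lt_neqAle eq_sym na0 nval_ge0.
have /(ler_wpM2l (ltW na)) := le a^-1 (a *: x).
by rewrite scalerK// mulrA -nvalM divff// nval1 mul1r.
Qed.

Lemma c0_normD x y : c0_norm (x + y) <= Num.max (c0_norm x) (c0_norm y).
Proof.
apply: c0_norm_le => n; apply: le_trans (nvalD _ _) _.
by rewrite ge_max !le_max !nval_le_c0_norm orbT.
Qed.

Let c0_dist (x y : c0) : R := c0_norm (x - y).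

Let c0_distxx x : c0_dist x x = 0.
Proof. by apply/c0_norm_eq0; rewrite subrr. Qed.

Let c0_dist_positivity x y : c0_dist x y = 0 -> x = y.
Proof. by move/c0_norm_eq0/eqP; rewrite subr_eq0 => /eqP. Qed.

Let c0_dist_sym x y : c0_dist x y = c0_dist y x.
Proof.
by rewrite /c0_dist -opprB -scaleN1r c0_normZ nvalN nval1 mul1r.
Qed.

Let c0_dist_triangle y x z : c0_dist x z <= c0_dist x y + c0_dist y z.
Proof.
rewrite /c0_dist -[x - z](subrKA y) (le_trans (c0_normD _ _))// ge_max.
by rewrite lerDl lerDr !c0_norm_ge0.
Qed.

HB.instance Definition _ := isMetric.Build R c0
  c0_distxx c0_dist_positivity c0_dist_sym c0_dist_triangle.

HB.instance Definition _ := Metric_isNANormed.Build R K c0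
  c0_norm_ge0 c0_norm_eq0 c0_normZ c0_normD (fun _ _ => erefl).

Lemma backward_shift_subproof (x : c0) : (fun n => x n.+1) \in c0_pred.
Proof.
case: x => x /= /c0_predP hx; apply/c0_predP => e /hx[N _ hN].
by exists N => // n /= Nn; apply: hN => /=; exact: leqW.
Qed.

Definition backward_shift (x : c0) : c0 := C0 (backward_shift_subproof x).

Lemma backward_shift_is_linear : linear backward_shift.
Proof. by move=> a x y; apply/val_inj. Qed.

HB.instance Definition _ :=
  GRing.isLinear.Build K c0 c0 _ backward_shift backward_shift_is_linear.

Definition shift_comb (lambda mu : K) : c0 -> c0 :=
  fun x => lambda *: x + mu *: backward_shift x.

Lemma shift_comb_is_linear lambda mu : linear (shift_comb lambda mu).
Proof.
move=> a x y; rewrite /shift_comb [backward_shift _]linearP !scalerDr !scalerA.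
by rewrite [lambda * a]mulrC [mu * a]mulrC addrACA.
Qed.

HB.instance Definition _ lambda mu := GRing.isLinear.Build K c0 c0 _
  (shift_comb lambda mu) (shift_comb_is_linear lambda mu).

Lemma shift_comb_continuous lambda mu : continuous (shift_comb lambda mu).
Proof.
move=> x; apply/(@cvg_ballP R c0 c0 (nbhs x) _) => e e0.
pose C := Num.max (nval lambda) (nval mu) + 1.
have Cgt0 : 0 < C by rewrite ltr_wpDl// le_max nval_ge0.
have leC (z : c0) : c0_norm (shift_comb lambda mu z) <= C * c0_norm z.
  apply: c0_norm_le => n; apply: le_trans (nvalD _ _) _.
  have lC : nval lambda <= C by rewrite ler_wpDr// le_max lexx.
  have mC : nval mu <= C by rewrite ler_wpDr// le_max lexx orbT.
  rewrite ge_max !nvalM; apply/andP; split; apply: ler_pM;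
    rewrite ?nval_ge0//.
    exact: (nval_le_c0_norm z n).
  exact: (nval_le_c0_norm z n.+1).
apply/nbhs_ballP; exists (e / C); first exact: divr_gt0.
move=> y; rewrite !ballEmdist/= !mdist_nnorm -linearB => xy.
by rewrite (le_lt_trans (leC _))// mulrC -ltr_pdivlMr.
Qed.

End C0.

Arguments c0 {R} K.
Arguments shift_comb {R K} lambda mu.

(* Main.v *)
Require Import Defs.
From mathcomp Require Import all_boot all_order all_algebra.
From mathcomp Require Import all_classical all_reals topology.
From mathcomp Require Import sequences lra.

Set Implicit Arguments.
Unset Strict Implicit.
Unset Printing Implicit Defensive.

Import Order.TTheory GRing.Theory Num.Theory.
Import numFieldTopology.Exports.

Local Open Scope classical_set_scope.
Local Open Scope ring_scope.

(** The comparison of [|lambda|] with [|mu|] decides everything, and both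
    implications towards it, as well as both implications from it, are proved
    directly, without a Baire category argument.

    Suppose [|mu| <= |lambda|].  For a nonzero null sequence [x], let [N] be the
    last index at which the supremum of the [|x_n|] is attained; such a strict
    peak exists because [x] tends to 0.  By the ultrametric inequality,
    [lambda x_N + mu x_(N+1)] has value [|lambda| |x_N|], and all later
    coordinates of the image are strictly smaller.  Hence [T = lambda + mu B] is
    [|lambda|] times an isometry ([nnorm_shift_comb]), and peaks stay peaks
    ([shift_comb_peak]).  The isometry rules out the Supercyclic Criterion, since
    [|T^n x| |S_n y| = |x| |T^n S_n y|] would tend to [|x| |y|].  The fixed peak
    rules out supercyclicity: every [a T^n x] has its coordinate [N+1] dominated
    by its coordinate [N], so none of them lies at distance less than 1 from
    [e_(N+1)].

    Suppose [|lambda| < |mu|].  Put [c = lambda / mu] and [A = c + B], so that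
    [T^n = mu^n A^n] and [|c| < 1].  Then [A^n x] tends to 0 for every [x]
    ([iter_cvg0]): the small tail of [x] stays small, and the finitely many other
    coordinates are contracted one after the other, starting from the last.
    Also, [A] has a right inverse [S] that does not increase norms, obtained by
    solving [c y_n + y_(n+1) = x_n] from [y_0 = 0].  The Criterion follows with
    both dense sets equal to the whole space and [S_n = mu^(-n) S^n].  A
    supercyclic vector is a lacunary series [sum_k a_k S^(n_k) y_k], where [y_k]
    runs through a countable dense set ([exists_universal_vector]): applying
    [A^(n_k) / a_k] kills the earlier terms, turns the [k]-th term into [y_k], and
    leaves the later ones negligible because the [a_k] decrease fast. *)

(** * Density and non-Archimedean norms *)

Lemma dense_mdistP (R : realType) (T : metricType R) (D : set T) :
  dense D <-> forall z e, 0 < e -> exists2 y, D y & mdist z y < e.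
Proof.
split=> [dD z e e0|dD O [z Oz] oO].
  have [y [zy Dy]] : (ball z e)^° `&` D !=set0.
    apply: dD; last exact: open_interior.
    by exists z; exact: nbhsx_ballx.
  by exists y => //; move/interior_subset: zy; rewrite ballEmdist.
have /nbhs_ballP[e /= e0 eO] : nbhs z O by apply: open_nbhs_nbhs.
have [y Dy zy] := dD z e e0.
by exists y; split=> //; apply: eO; rewrite ballEmdist.
Qed.

Lemma exprn_lt_eventually (R : realType) (q e : R) : 0 <= q < 1 -> 0 < e ->
  exists N, forall n, (N <= n)%N -> q ^+ n < e.
Proof.
move=> /andP[q0 q1] e0.
have /cvg_ballP/(_ e e0)[N _ hN] : (GRing.exp q : nat -> R) @ \oo --> (0 : R).
  by apply: cvg_expr; rewrite ger0_norm.
exists N => n /hN.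
by rewrite /ball/= sub0r normrN ger0_norm// exprn_ge0.
Qed.

(** Both the orbit of a coordinate under [c + B] and the right inverse of [c + B]
    are driven by such a recursion, with [q = |c|]; there [e] bounds the next
    coordinate, respectively the data of the equation being solved. *)
Lemma contraction_eventually (R : realType) (q e : R) (u : nat -> R) :
    0 <= q < 1 -> 0 < e ->
    (forall n, u n.+1 <= Num.max (q * u n) e) ->
  exists N, forall n, (N <= n)%N -> u n <= e.
Proof.
move=> q01 e0 hu; have /andP[q0 q1] := q01.
have le_max n : u n <= Num.max (q ^+ n * u 0) e.
  elim: n => [|n IH]; first by rewrite expr0 mul1r le_max lexx.
  apply: le_trans (hu n) _; rewrite ge_max [X in _ && X]le_max lexx orbT andbT.
  apply: le_trans (ler_wpM2l q0 IH) _.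
  rewrite maxr_pMr// ge_max exprS mulrA le_max lexx/= le_max.
  by apply/orP; right; rewrite ger_pMl// ltW.
have M0 : 0 < `|u 0| + 1 by rewrite ltr_wpDl.
have [N hN] := exprn_lt_eventually q01 (divr_gt0 e0 M0).
exists N => n /hN qn; apply: le_trans (le_max n) _; rewrite ge_max lexx andbT.
apply: (@le_trans _ _ (q ^+ n * (`|u 0| + 1))).
  by rewrite ler_wpM2l ?exprn_ge0// ler_wpDr// ler_norm.
by rewrite -ler_pdivlMr// ltW.
Qed.

Section NAValuedField.
Variables (R : realType) (K : naValuedFieldType R).
Implicit Types x y : K.

Lemma nval_gt0 x : (0 < nval x) = (x != 0).
Proof.
rewrite lt_neqAle nval_ge0 andbT eq_sym; congr (~~ _).
by apply/eqP/eqP => /nval_eq0.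
Qed.

Lemma nvalV x : nval x^-1 = (nval x)^-1.
Proof.
have [->|x0] := eqVneq x 0; first by rewrite invr0 nval0 invr0.
have nx : nval x != 0 by rewrite gt_eqF// nval_gt0.
by apply: (mulfI nx); rewrite -nvalM !divff// nval1.
Qed.

Lemma nvalX x n : nval (x ^+ n) = nval x ^+ n.
Proof. by elim: n => [|n IH]; rewrite ?expr0 ?nval1// !exprS nvalM IH. Qed.

Lemma nvalB x y : nval (x - y) <= Num.max (nval x) (nval y).
Proof. by rewrite (le_trans (nvalD _ _))// nvalN. Qed.

(** Otherwise [x = (x + y) - y] would be a difference of two strictly smaller
    elements. *)
Lemma nvalD_dominant x y : nval y < nval x -> nval (x + y) = nval x.
Proof.
move=> yx; apply/eqP; rewrite eq_le; apply/andP; split.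
  by rewrite (le_trans (nvalD _ _))// ge_max lexx ltW.
have := nvalB (x + y) y; rewrite addrK le_max => /orP[//|xy].
by have := lt_le_trans yx xy; rewrite ltxx.
Qed.

Lemma exists_small_scalar (e : R) : 0 < e -> exists2 a : K, a != 0 & nval a < e.
Proof.
move=> e0.
have [p p0 p1] : exists2 p : K, p != 0 & nval p < 1.
  have [x x0 x1] := @nval_nontrivial R K.
  have [lt1|] := ltP (nval x) 1; first by exists x.
  rewrite le_eqVlt eq_sym (negPf x1)/= => gt1.
  by exists x^-1; rewrite ?invr_eq0// nvalV invf_lt1// nval_gt0.
have p01 : 0 <= nval p < 1 by rewrite nval_ge0.
have [N /(_ N (leqnn _)) pN] := exprn_lt_eventually p01 e0.
by exists (p ^+ N); rewrite ?expf_neq0// nvalX.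
Qed.

End NAValuedField.

Section NANormed.
Variables (R : realType) (K : naValuedFieldType R) (X : naNormedModType K).
Implicit Types (x y z : X) (D : set X).

Lemma nnormN x : nnorm (- x) = nnorm x.
Proof. by rewrite -scaleN1r nnormZ nvalN nval1 mul1r. Qed.

Lemma nnorm0 : nnorm (0 : X) = 0.
Proof. exact/nnorm_eq0. Qed.

Lemma nnorm_gt0 x : (0 < nnorm x) = (x != 0).
Proof.
rewrite lt_neqAle nnorm_ge0 andbT eq_sym; congr (~~ _).
by apply/eqP/eqP => /nnorm_eq0.
Qed.

Lemma nnormD_lt x y (e : R) : nnorm x < e -> nnorm y < e -> nnorm (x + y) < e.
Proof. by move=> xe ye; rewrite (le_lt_trans (nnormD _ _))// gt_max xe. Qed.

Lemma dense_nnormP D :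
  dense D <-> forall z e, 0 < e -> exists2 y, D y & nnorm (z - y) < e.
Proof.
apply: (iff_trans (dense_mdistP D)).
by split=> h z e /(h z)[y Dy ye]; exists y; rewrite // ?mdist_nnorm// -mdist_nnorm.
Qed.

Lemma dense_neq0 D z : z != 0 -> dense D -> exists2 x, D x & x != 0.
Proof.
rewrite -nnorm_gt0 => z0 /dense_nnormP/(_ z _ z0)[x Dx zx]; exists x => //.
by apply: contraTneq zx => ->; rewrite subr0 ltxx.
Qed.

Lemma cvg_nnormP (u : nat -> X) x : u @ \oo --> x <->
  forall e, 0 < e -> \forall n \near \oo, nnorm (x - u n) < e.
Proof.
split=> [/cvg_ballP h e /h|h]; last apply/cvg_ballP => e /h.
  by apply: filterS => n; rewrite ballEmdist/= mdist_nnorm.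
by apply: filterS => n; rewrite ballEmdist/= mdist_nnorm.
Qed.

Lemma iter_linearD (T : {linear X -> X}) n x y :
  iter n T (x + y) = iter n T x + iter n T y.
Proof. by elim: n => //= n ->; rewrite linearD. Qed.

Lemma iter_linearZ (T : {linear X -> X}) n (a : K) x :
  iter n T (a *: x) = a *: iter n T x.
Proof. by elim: n => //= n ->; rewrite linearZ. Qed.

End NANormed.

(** * Finitely supported sequences *)

Section C0Coordinates.
Variables (R : realType) (K : naValuedFieldType R).
Implicit Types (x y z : c0 K) (l m : K).

Lemma c0P x y : (forall n, x n = y n) -> x = y.
Proof. by move=> xy; apply/val_inj/funext. Qed.

Lemma c0D x y n : (x + y) n = (x n : K) + (y n : K). Proof. by []. Qed.

Lemma c0B x y n : (x - y) n = (x n : K) - (y n : K). Proof. by []. Qed.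

Lemma c0Z (a : K) x n : (a *: x) n = a * (x n : K). Proof. by []. Qed.

Lemma shift_combE l m x n : shift_comb l m x n = l * (x n : K) + m * (x n.+1 : K).
Proof. by []. Qed.

Lemma c0_eventually_lt x (e : R) : 0 < e ->
  exists N, forall n, (N <= n)%N -> nval (x n : K) < e.
Proof. by case: x => x /= /c0_predP h /h[N _ hN]; exists N => n /hN. Qed.

Lemma fin_seq_subproof (s : seq K) : (fun n => nth 0 s n : K^o) \in @c0_pred R K.
Proof.
apply/c0_predP => e e0; exists (size s) => // n /= sn.
by rewrite nth_default// nval0.
Qed.

Definition fin_seq (s : seq K) : c0 K := C0 (fin_seq_subproof s).

Lemma fin_seqE s n : fin_seq s n = nth 0 s n :> K. Proof. by []. Qed.

Definition unit_seq n : c0 K := fin_seq (ncons n 0 [:: 1]).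

Lemma unit_seqE n i : unit_seq n i = (i == n)%:R :> K.
Proof.
rewrite fin_seqE nth_ncons; case: (ltngtP i n) => // [ni|->]; last by rewrite subnn.
by rewrite nth_default//= subn_gt0.
Qed.

Lemma unit_seq_neq0 n : unit_seq n != 0.
Proof.
apply/eqP => /(congr1 (fun x : c0 K => x n : K))/eqP.
by rewrite unit_seqE eqxx oner_eq0.
Qed.

(** Truncating a null sequence and rounding the remaining coordinates to a
    countable dense set [d 0, d 1, ...] of scalars gives a countable dense set
    of null sequences. *)
Lemma fin_seq_dense (d : nat -> K) : dense (range d) ->
  forall z (e : R), 0 < e -> exists s, nnorm (z - fin_seq (map d s)) < e.
Proof.
move=> /dense_mdistP dD z e e0.
have e20 : 0 < e / 2 by rewrite divr_gt0.
have /choice[t ht] : forall i, exists k, nval ((z i : K) - d k) < e / 2.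
  by move=> i; have [_ [k _ <-]] := dD (z i) _ e20; rewrite mdist_nval; exists k.
have [N hN] := c0_eventually_lt z e20.
exists (mkseq t N); apply: (@le_lt_trans _ _ (e / 2)); last lra.
apply: c0_norm_le => i; rewrite c0B fin_seqE.
have [iN|Ni] := ltnP i N.
  by rewrite (nth_map 0%N) ?size_mkseq// nth_mkseq// ltW.
by rewrite nth_default ?subr0 ?(ltW (hN _ _))// size_map size_mkseq.
Qed.

Lemma separable_enum : separable_space K -> exists d : nat -> K, dense (range d).
Proof.
move=> [D /pfcard_geP[->|[d]] dD]; first by have := dense0 dD.
exists d; suff -> : range d = D by [].
by apply/image_eq.
Qed.

End C0Coordinates.

(** * The operator [lambda + mu B] when [|mu| <= |lambda|] *)

Section Peak.
Variables (R : realType) (K : naValuedFieldType R) (l m : K).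
Hypothesis ml : nval m <= nval l.
Implicit Types x y z : c0 K.

Definition peak N y := forall n, (N < n)%N -> nval (y n : K) < nval (y N : K).

(** The supremum is attained because [y] tends to 0, and the last index that
    attains it is a peak.  It is found by descending from an index [M] from which
    on no coordinate reaches the current candidate [i]. *)
Lemma exists_peak y : y != 0 -> exists2 N, peak N y & nnorm y = nval (y N : K).
Proof.
move=> y0.
have [i yi0] : exists i, (y i : K) != 0.
  apply: contrapT => /forallNP yz; move/eqP: y0; apply; apply: c0P => n.
  exact/eqP/negPn/negP/yz.
have [M hM] : exists M, forall n, (M <= n)%N -> nval (y n : K) < nval (y i : K).
  by apply: c0_eventually_lt; rewrite nval_gt0.
elim: M i {yi0} hM => [|M IH] i hM.
  by have := hM i (leq0n _); rewrite ltxx.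
have [[j yj]|/forallNP yM] :=
    pselect (exists j, nval (y M : K) < nval (y j : K)).
  have [yMi|yiM] := ltP (nval (y M : K)) (nval (y i : K)).
    by apply: (IH i) => n; rewrite leq_eqVlt => /orP[/eqP<-//|/hM].
  apply: (IH j) => n; rewrite leq_eqVlt => /orP[/eqP<-//|/hM yn].
  exact: lt_trans (lt_le_trans yn yiM) yj.
have yMmax j : nval (y j : K) <= nval (y M : K) by rewrite leNgt; apply/negP/yM.
exists M; first by move=> n /hM yn; exact: lt_le_trans yn (yMmax i).
by apply/eqP; rewrite eq_le nval_le_c0_norm andbT; exact: c0_norm_le.
Qed.

Lemma peak_coord N y : l != 0 -> peak N y ->
  nval (shift_comb l m y N : K) = nval l * nval (y N : K).
Proof.
move=> l0 py; rewrite shift_combE nvalD_dominant ?nvalM//.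
apply: le_lt_trans (ler_wpM2r (nval_ge0 _) ml) _.
by rewrite ltr_pM2l ?nval_gt0// py.
Qed.

Lemma shift_comb_peak N y : l != 0 -> peak N y -> peak N (shift_comb l m y).
Proof.
move=> l0 py n Nn; rewrite (peak_coord l0 py) shift_combE.
rewrite (le_lt_trans (nvalD _ _))// !nvalM gt_max.
rewrite ltr_pM2l ?nval_gt0// py//=.
apply: le_lt_trans (ler_wpM2r (nval_ge0 _) ml) _.
by rewrite ltr_pM2l ?nval_gt0// py// ltnW.
Qed.

Lemma shift_comb_eq0 y : l = 0 -> shift_comb l m y = 0.
Proof.
move=> l0; have m0 : m = 0.
  by apply/nval_eq0/eqP; rewrite eq_le nval_ge0 (le_trans ml)// l0 nval0.
by rewrite /shift_comb l0 m0 !scale0r addr0.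
Qed.

(** The coordinate at the peak cannot be cancelled by the next one, so the
    operator is a multiple of an isometry. *)
Lemma nnorm_shift_comb y : nnorm (shift_comb l m y) = nval l * nnorm y.
Proof.
have [l0|l0] := eqVneq l 0.
  by rewrite shift_comb_eq0// nnorm0 l0 nval0 mul0r.
have [->|/exists_peak[N py yNE]] := eqVneq y 0.
  by rewrite linear0 !nnorm0 mulr0.
rewrite yNE; apply/eqP; rewrite eq_le -{2}(peak_coord l0 py) nval_le_c0_norm andbT.
apply: c0_norm_le => n; rewrite shift_combE (le_trans (nvalD _ _))// !nvalM.
have yN k : nval (y k : K) <= nval (y N : K) by rewrite -yNE; exact: nval_le_c0_norm.
rewrite ge_max ler_wpM2l ?nval_ge0//=.
by apply: ler_pM; rewrite ?nval_ge0.
Qed.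

Lemma nnorm_iter_shift_comb n y :
  nnorm (iter n (shift_comb l m) y) = nval l ^+ n * nnorm y.
Proof.
elim: n => [|n IH]; first by rewrite expr0 mul1r.
by rewrite iterS nnorm_shift_comb IH exprS mulrA.
Qed.

(** [|T^n x| |S_n y| = |x| |T^n (S_n y)|], whose limit would be [|x| |y|]. *)
Lemma not_supercyclic_criterion : ~ supercyclic_criterion (shift_comb l m).
Proof.
move=> [n_ [D1 [D2 [S [_ dD1 dD2 small approx]]]]].
have [x D1x x0] := dense_neq0 (unit_seq_neq0 K 0) dD1.
have [y D2y y0] := dense_neq0 (unit_seq_neq0 K 0) dD2.
pose y' : D2 := exist _ y (mem_set D2y).
have e0 : 0 < nnorm x * nnorm y by rewrite mulr_gt0 ?nnorm_gt0.
have /cvg_ballP/(_ _ e0) hsmall := small x y' D1x.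
have y_gt0 : 0 < nnorm y by rewrite nnorm_gt0.
have /cvg_nnormP/(_ _ y_gt0) happrox := approx y'.
have [k [sk ak]] : exists k,
  nnorm (iter (n_ k) (shift_comb l m) x) * nnorm (S (n_ k) y') < nnorm x * nnorm y
  /\ nnorm (y - iter (n_ k) (shift_comb l m) (S (n_ k) y')) < nnorm y.
  have [k [/= sk ak]] := filter_ex (filterI hsmall happrox).
  exists k; split => //; move: sk.
  by rewrite /ball/= sub0r normrN ger0_norm// mulr_ge0 ?nnorm_ge0.
move: sk.
rewrite nnorm_iter_shift_comb mulrAC -nnorm_iter_shift_comb mulrC ltr_pM2l ?nnorm_gt0// => sk.
have := nnormD_lt ak sk.
by rewrite subrK ltxx.
Qed.

(** The iterates of [x] share the peak [N] unless they vanish, so in the whole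
    projective orbit the coordinate [N.+1] is dominated by the coordinate [N],
    and [e_(N+1)] is out of reach. *)
Lemma not_supercyclic : ~ supercyclic (shift_comb l m).
Proof.
move=> [x /dense_nnormP dx].
have [N px] : exists N, x = 0 \/ peak N x.
  have [->|/exists_peak[N pN _]] := eqVneq x 0; first by exists 0%N; left.
  by exists N; right.
have orbit n : iter n (shift_comb l m) x = 0 \/ peak N (iter n (shift_comb l m) x).
  elim: n => [//|n]; rewrite iterS => -[->|pn]; first by left; rewrite linear0.
  have [l0|l0] := eqVneq l 0; first by left; exact: shift_comb_eq0.
  by right; exact: shift_comb_peak.
have [_ [a [n ->]]] := dx (unit_seq K N.+1) 1 ltr01.
set w := iter n _ x => dist1.
have wN : nval (a * w N.+1) <= nval (a * w N).
  rewrite !nvalM ler_wpM2l ?nval_ge0//.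
  have [->|/(_ _ (ltnSn N))/ltW//] : w = 0 \/ peak N w := orbit n.
  by rewrite lexx.
have coord i : nval (unit_seq K N.+1 i - a * w i) < 1.
  exact: le_lt_trans (nval_le_c0_norm _ i) dist1.
have := coord N; rewrite unit_seqE ltn_eqF// sub0r nvalN => awN.
have := coord N.+1; rewrite unit_seqE eqxx => awN1.
have := nvalD (1 - a * w N.+1) (a * w N.+1).
rewrite subrK nval1 le_max !leNgt awN1 /=.
by rewrite (le_lt_trans wN awN).
Qed.

End Peak.

(** * The operator [c + B] when [|c| < 1] *)

Section ContractingDiagonal.
Variables (R : realType) (K : naValuedFieldType R) (c : K).
Hypothesis c_lt1 : nval c < 1.
Implicit Types x y z : c0 K.

Let A : {linear c0 K -> c0 K} := shift_comb c 1.

Let AE x n : A x n = c * (x n : K) + (x n.+1 : K) :> K.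
Proof. by rewrite [LHS]shift_combE mul1r. Qed.

Let c01 : 0 <= nval c < 1. Proof. by rewrite nval_ge0. Qed.

Lemma nnorm_iter_le n x : nnorm (iter n A x) <= nnorm x.
Proof.
elim: n => //= n IH; apply: le_trans _ IH; set y := iter n A x.
apply: c0_norm_le => i; rewrite AE (le_trans (nvalD _ _))// nvalM ge_max.
rewrite nval_le_c0_norm andbT; apply: le_trans (nval_le_c0_norm y i).
by rewrite ler_piMl ?nval_ge0// ltW.
Qed.

(** Once every coordinate after [M] is at most [e / 2], it stays so, and then the
    coordinate [M] contracts by the factor [|c|] until it is at most [e / 2] too;
    iterate downwards on [M]. *)
Lemma iter_cvg0 x (e : R) : 0 < e ->
  exists N, forall n, (N <= n)%N -> nnorm (iter n A x) < e.
Proof.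
move=> e0; have e20 : 0 < e / 2 by rewrite divr_gt0.
suff [N hN] : exists N, nnorm (iter N A x) <= e / 2.
  exists N => n Nn; rewrite -(subnK Nn) iterD.
  by rewrite (le_lt_trans (nnorm_iter_le _ _))// (le_lt_trans hN)//; lra.
have [M] := c0_eventually_lt x e20.
move=> /(_ _ _)/ltW; elim: M x => [|M IH] x hM.
  by exists 0%N; apply: c0_norm_le => n; exact: hM.
have tail n i : (M < i)%N -> nval (iter n A x i : K) <= e / 2.
  elim: n i => [|n IHn] i Mi; first exact: hM.
  rewrite iterS AE (le_trans (nvalD _ _))// nvalM ge_max IHn ?andbT; last exact: leqW.
  apply: le_trans (IHn _ Mi).
  by rewrite ler_piMl ?nval_ge0// ltW.
have [n0 hn0] : exists N, forall n, (N <= n)%N -> nval (iter n A x M : K) <= e / 2.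
  apply: (contraction_eventually c01 e20) => n.
  rewrite iterS AE (le_trans (nvalD _ _))// nvalM ge_max !le_max lexx/=.
  by rewrite tail ?orbT.
have [n hn] : exists n, nnorm (iter n A (iter n0 A x)) <= e / 2.
  apply: IH => i; rewrite leq_eqVlt => /orP[/eqP<-|]; first exact: hn0.
  exact: tail.
by exists (n + n0)%N; rewrite iterD.
Qed.

(** The solution of [c * y n + y n.+1 = x n] with [y 0 = 0]. *)
Fixpoint right_inv_seq (x : nat -> K) (n : nat) : K :=
  if n is n'.+1 then x n' - c * right_inv_seq x n' else 0.

Lemma right_inv_seq_c0 x : (right_inv_seq x : nat -> K^o) \in @c0_pred R K.
Proof.
apply/c0_predP => e e0; have e20 : 0 < e / 2 by rewrite divr_gt0.
have [N hN] := c0_eventually_lt x e20.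
have [M hM] : exists M, forall n, (M <= n)%N ->
    nval (right_inv_seq x (n + N)) <= e / 2.
  apply: (contraction_eventually c01 e20) => n.
  rewrite addSn /= (le_trans (nvalB _ _))// nvalM ge_max !le_max lexx/=.
  by rewrite (ltW (hN _ _)) ?orbT// leq_addl.
exists (M + N)%N => // n /= MNn.
have Nn : (N <= n)%N by apply: leq_trans MNn; rewrite leq_addl.
rewrite -(subnK Nn); apply: (@le_lt_trans _ _ (e / 2)); last lra.
by apply: hM; rewrite leq_subRL// addnC.
Qed.

Definition right_inv x : c0 K := C0 (right_inv_seq_c0 x).

Lemma right_invK : cancel right_inv A.
Proof. by move=> x; apply: c0P => n; rewrite AE/= addrC subrK. Qed.

Lemma iter_right_invK n : cancel (iter n right_inv) (iter n A).
Proof.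
by elim: n => // n IH x; rewrite iterSr iterS right_invK IH.
Qed.

Lemma nnorm_right_inv_iter n x : nnorm (iter n right_inv x) <= nnorm x.
Proof.
elim: n => //= n; apply: le_trans; set y := iter n _ x.
apply: c0_norm_le; elim=> [|i IH] /=; first by rewrite nval0 c0_norm_ge0.
rewrite (le_trans (nvalB _ _))// ge_max nval_le_c0_norm/= nvalM.
by rewrite (le_trans _ IH)// ler_piMl ?nval_ge0// ltW.
Qed.

Lemma right_inv_iter_coord0 n x i : (i < n)%N -> iter n right_inv x i = 0 :> K.
Proof.
elim: n i => // n IH; rewrite [iter _ _ _]iterS; set y := iter n _ x in IH *.
elim=> [//|i IHi] ltin.
have -> : right_inv y i.+1 = (y i : K) - c * (right_inv y i : K) by [].
by rewrite IH// IHi ?mulr0 ?subr0// ltnW.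
Qed.

(** The vector is [sum_k a_k S^(n_k) y_k], with [S] the right inverse above.
    The scalar [a_k] is chosen first, so small that the [k]-th term does not
    disturb the earlier stages; then the exponent [n_k] is taken so large that
    [A^(n_k)] makes the earlier terms negligible even relatively to [a_k].  As [S^n] fills the first [n] coordinates with zeros
    and [k <= n_k], every coordinate of the sum is a finite sum. *)
Lemma exists_universal_vector (y : nat -> c0 K) (eps : nat -> R) :
    (forall k, 0 < eps k) ->
  exists x, forall k, exists (a : K) n, nnorm (y k - a *: iter n A x) < eps k.
Proof.
move=> eps0.
have /choice[f hf] : forall t : nat * (c0 K * R), exists p : K * nat,
    0 < t.2.2 -> [/\ p.1 != 0, nval p.1 * nnorm (y t.1) <= t.2.2,
      (t.1 <= p.2)%N & nnorm (iter p.2 A t.2.1) < nval p.1 * eps t.1].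
  move=> [k [z r]] /=; have [r0|_] := ltP 0 r; last by exists (0, 0%N).
  have y1 : 0 < nnorm (y k) + 1 by rewrite ltr_wpDl ?nnorm_ge0.
  have [a a0 ar] := exists_small_scalar K (divr_gt0 r0 y1).
  have ae : 0 < nval a * eps k by rewrite mulr_gt0 ?nval_gt0.
  have [N hN] := iter_cvg0 z ae.
  exists (a, maxn N k) => _ /=; split; rewrite ?leq_maxr ?hN ?leq_maxl//.
  move: ar; rewrite ltr_pdivlMr// => /ltW; apply: le_trans.
  by rewrite ler_wpM2l ?nval_ge0// lerDl.
(* [z k] is the sum of the terms before [k], and [r k] bounds all the terms
   from [k] on.  Halving sends [r] to 0 and makes the terms after [k] strictly
   smaller than [|a k| eps k]. *)
pose st := fix st k : c0 K * R := if k is j.+1 then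
  let p := f (j, st j) in
  ((st j).1 + p.1 *: iter p.2 right_inv (y j),
   Num.min (st j).2 (nval p.1 * eps j) / 2) else (0, 1).
pose z k := (st k).1; pose r k := (st k).2.
pose a k := (f (k, st k)).1; pose n k := (f (k, st k)).2.
have zS k : z k.+1 = z k + a k *: iter (n k) right_inv (y k) by [].
have rS k : r k.+1 = Num.min (r k) (nval (a k) * eps k) / 2 by [].
have r_gt0 k : 0 < r k.
  elim: k => [|k IH]; first exact: ltr01.
  have [ak _ _ _] := hf (k, st k) IH.
  by rewrite rS divr_gt0// lt_min IH mulr_gt0 ?nval_gt0.
have a_neq0 k : a k != 0 by have [] := hf (k, st k) (r_gt0 k).
have a_small k : nval (a k) * nnorm (y k) <= r k.
  by have [] := hf (k, st k) (r_gt0 k).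
have n_ge k : (k <= n k)%N by have [] := hf (k, st k) (r_gt0 k).
have n_large k : nnorm (iter (n k) A (z k)) < nval (a k) * eps k.
  by have [] := hf (k, st k) (r_gt0 k).
have r_half k : r k.+1 <= r k / 2.
  by rewrite rS ler_pM2r ?invr_gt0// ge_min lexx.
have r_dec k j : r (j + k)%N <= r k.
  elim: j => // j; apply: le_trans; apply: le_trans (r_half _) _.
  by rewrite ler_pdivrMr// ler_peMr ?ler1n// ltW.
have r_small e : 0 < e -> exists k, r k < e.
  move=> e0; have half01 : 0 <= (2^-1 : R) < 1 by lra.
  have [k /(_ k (leqnn _)) ke] := exprn_lt_eventually half01 e0.
  exists k; apply: le_lt_trans ke; elim: k => [|k IH]; first by rewrite expr0.
  by rewrite (le_trans (r_half _))// exprSr ler_pM2r ?invr_gt0.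
have z_tail k j : nnorm (z (j + k)%N - z k) <= r k.
  elim: j => [|j IH]; first by rewrite subrr nnorm0 ltW.
  rewrite addSn zS addrAC (le_trans (nnormD _ _))// ge_max IH/= nnormZ.
  apply: le_trans (r_dec k j); apply: le_trans (a_small _).
  by rewrite ler_wpM2l ?nval_ge0// nnorm_right_inv_iter.
have z_stable i j : z (j + i.+1)%N i = z i.+1 i :> K.
  elim: j => // j <-; rewrite addSn zS c0D c0Z.
  rewrite right_inv_iter_coord0 ?mulr0 ?addr0//.
  by apply: leq_trans (n_ge _); rewrite addnS ltnS leq_addl.
have x_tail k i : nval ((z i.+1 i : K) - (z k i : K)) <= r k.
  rewrite -(z_stable i k) addnC; apply: le_trans (z_tail k i.+1).
  exact: (nval_le_c0_norm (z (i.+1 + k)%N - z k) i).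
have x_c0 : (fun i => z i.+1 i) \in @c0_pred R K.
  apply/c0_predP => e /[dup] e0 /r_small[k rk].
  have [N hN] := c0_eventually_lt (z k) e0.
  exists N => // i /hN zi; rewrite -[z i.+1 i](subrK (z k i : K)).
  by rewrite (le_lt_trans (nvalD _ _))// gt_max zi (le_lt_trans (x_tail k i)).
pose x := C0 x_c0; exists x => k; exists (a k)^-1, (n k).
have ak_gt0 : 0 < nval (a k) by rewrite nval_gt0.
rewrite -(ltr_pM2l ak_gt0) -nnormZ scalerBr scalerA divff// scale1r.
have xE : x = z k + a k *: iter (n k) right_inv (y k) + (x - z k.+1).
  by rewrite -zS addrC subrK.
rewrite [in iter _ _ _]xE iter_linearD (iter_linearD _ _ (z k)).
rewrite iter_linearZ iter_right_invK.
rewrite -addrA addrCA opprD addrA subrr sub0r nnormN nnormD_lt//.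
apply: le_lt_trans (nnorm_iter_le _ _) _.
apply: (@le_lt_trans _ _ (r k.+1)); first exact/c0_norm_le/x_tail.
have ae : 0 < nval (a k) * eps k by rewrite mulr_gt0.
apply: (@le_lt_trans _ _ (nval (a k) * eps k / 2)); last lra.
by rewrite rS ler_pM2r ?invr_gt0// ge_min lexx orbT.
Qed.

(** The stages of a universal vector run over pairs of a finitely supported
    target and a precision [2^(-m)], so that each target is approached with
    every precision. *)
Lemma supercyclic_contracting_diagonal :
  separable_space K -> supercyclic (shift_comb c 1).
Proof.
move=> /separable_enum[d dd].
pose stage k : seq nat * nat := odflt ([::], 0%N) (unpickle k).
have eps0 k : 0 < (2^-1 : R) ^+ (stage k).2 by rewrite exprn_gt0// invr_gt0.
have [x hx] := exists_universal_vector (fun k => fin_seq (map d (stage k).1)) eps0.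
exists x; apply/dense_nnormP => z e e0.
have [s zs] := fin_seq_dense dd z e0.
have half01 : 0 <= (2^-1 : R) < 1 by lra.
have [m /(_ m (leqnn _)) me] := exprn_lt_eventually half01 e0.
have [a [n]] := hx (pickle (s, m)); rewrite /stage pickleK/= => xs.
exists (a *: iter n A x); first by exists a, n.
rewrite -(subrK (fin_seq (map d s)) z) -addrA.
exact: nnormD_lt zs (lt_trans xs me).
Qed.

End ContractingDiagonal.

(** * The operator [lambda + mu B] when [|lambda| < |mu|] *)

Section Dominated.
Variables (R : realType) (K : naValuedFieldType R) (l m : K).
Hypothesis lm : nval l < nval m.

Let m0 : m != 0. Proof. by rewrite -nval_gt0 (le_lt_trans (nval_ge0 l)). Qed.

Let c_lt1 : nval (l / m) < 1.
Proof. by rewrite nvalM nvalV ltr_pdivrMr ?mul1r// nval_gt0. Qed.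

Lemma iter_shift_comb_normalize n (x : c0 K) :
  iter n (shift_comb l m) x = m ^+ n *: iter n (shift_comb (l / m) 1) x.
Proof.
elim: n => [|n IH]; first by rewrite expr0 scale1r.
rewrite !iterS IH linearZ exprSr -scalerA; congr (_ *: _).
by rewrite /shift_comb scalerDr !scalerA mulr1 mulrCA mulfV// mulr1.
Qed.

Lemma supercyclic_dominated : separable_space K -> supercyclic (shift_comb l m).
Proof.
move=> /(supercyclic_contracting_diagonal c_lt1)[x /dense_nnormP dx].
exists x; apply/dense_nnormP => z e /(dx z)[_ [a [n ->]] ze].
exists (a *: iter n (shift_comb (l / m) 1) x) => //.
exists (a / m ^+ n), n.
by rewrite iter_shift_comb_normalize scalerA divfK ?expf_neq0.
Qed.

(** The factors [mu^n] of [T^n] and [mu^(-n)] of the approximate inverse cancel in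
    the product of the norms, which leaves at most [|A^n x| |y|], where
    [A = lambda / mu + B]. *)
Lemma supercyclic_criterion_dominated : supercyclic_criterion (shift_comb l m).
Proof.
exists id, setT, setT, (fun n y => m ^- n *: iter n (right_inv c_lt1) (val y)).
have denseT : dense [set: c0 K].
  by apply/dense_nnormP => z e e0; exists z; rewrite // subrr nnorm0.
split=> // [x y _|y].
  apply/cvg_ballP => e e0.
  have y1 : 0 < nnorm (val y) + 1 by rewrite ltr_wpDl ?nnorm_ge0.
  have [N hN] := iter_cvg0 c_lt1 x (divr_gt0 e0 y1).
  exists N => // n /= /hN; rewrite ltr_pdivlMr// => xn.
  rewrite /ball/= sub0r normrN ger0_norm ?mulr_ge0 ?nnorm_ge0//.
  apply: le_lt_trans xn.
  rewrite iter_shift_comb_normalize !nnormZ mulrACA nvalV mulfV ?mul1r; last first.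
    by rewrite gt_eqF// nval_gt0 expf_neq0.
  rewrite ler_wpM2l ?nnorm_ge0// (le_trans (nnorm_right_inv_iter _ _ _))//.
  by rewrite lerDl.
apply/cvg_nnormP => e e0; exists 0%N => // n _ /=.
rewrite iter_linearZ iter_shift_comb_normalize scalerA mulVf ?expf_neq0//.
by rewrite scale1r iter_right_invK subrr nnorm0.
Qed.

End Dominated.

Theorem theorem5p7 (R : realType) (K : completeNAValuedFieldType R)
    (K_separable : separable_space K) (lambda mu : K) :
  [<-> supercyclic_criterion (shift_comb lambda mu);
       supercyclic (shift_comb lambda mu);
       nval lambda < nval mu].
Proof.
tfae.
- move=> crit; apply: supercyclic_dominated => //.
  rewrite ltNge; apply/negP => ml; exact: (not_supercyclic_criterion ml crit).
- move=> sup; rewrite ltNge; apply/negP => ml; exact: (not_supercyclic ml sup).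
- exact: supercyclic_criterion_dominated.
Qed.
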